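(* Let $\beta\geq\frac{1+\sqrt5}{2}$ and let $\mathrm{d}_{-\beta}(l_\beta)=d_1d_2d_3\cdots$ satisfy $0<d_i$ and $d_1>d_{2i}$ for all $i=1,2,3,\dots$. Let $\Phi:\mathbb{N}^*\to\mathbb{N}^*$ be the antimorphism given on letters by \[ \Phi(0)=0^{d_1-1}1,\qquad \Phi(2\ell)=0^{d_{2\ell+1}-1}(2\ell+1)0^{d_1-d_{2\ell}-1}1\ (\ell\geq1),\qquad \Phi(2\ell+1)=0^{d_{2\ell+1}-1}(2\ell+2)0^{d_1-d_{2\ell+2}-1}1\ (\ell\geq0), \] where $(2\ell+1)$, $(2\ell+2)$ denote single letters of $\mathbb{N}$ and $0^j$ a block of $j$ letters $0$. Then for every $n\in\mathbb{Z}$, if $a<b$ are the indices with $z_a=-\beta z_{n+1}$ and $z_b=-\beta z_n$, one has $\Phi(v_n)=v_av_{a+1}\cdots v_{b-1}$; consequently $\Phi^2$ is a morphism fixing $\boldsymbol{v}_{-\beta}$.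
   Context: Let $\beta>1$, $\mathcal{A}_\beta=\{0,1,\dots,\lfloor\beta\rfloor\}$, $l_\beta=\frac{-\beta}{\beta+1}$, $r_\beta=\frac1{\beta+1}$, $I_\beta=[l_\beta,r_\beta)$, $T_{-\beta}(x)=-\beta x-\lfloor -\beta x+\frac{\beta}{\beta+1}\rfloor$ on $I_\beta$. The $(-\beta)$-expansion of $x\in I_\beta$ is $\mathrm{d}_{-\beta}(x)=x_1x_2\cdots$ with $x_i=\lfloor -\beta T_{-\beta}^{i-1}(x)+\frac{\beta}{\beta+1}\rfloor$; an infinite string over $\mathcal{A}_\beta$ is $(-\beta)$-admissible if it is $\mathrm{d}_{-\beta}(x)$ for some $x\in I_\beta$. Alternate order: $x_1x_2\cdots\prec_{\mathrm{alt}}y_1y_2\cdots$ if $(-1)^i(y_i-x_i)>0$ for the smallest $i$ with $x_i\ne y_i$. For a finite string $u=a_k\cdots a_0$, $\gamma(u)=\sum a_i(-\beta)^i$. $\mathbb{Z}_{-\beta}=\{\gamma(a_k\cdots a_0): a_k\cdots a_00^\omega\text{ admissible}\}$ ($0^\omega$ infinite repetition of $0$); it satisfies $-\beta\mathbb{Z}_{-\beta}\subset\mathbb{Z}_{-\beta}$. For $k\ge0$, $\mathcal{S}(k)$ is the set of admissible strings $a_{k-1}\cdots a_00^\omega$, with alternate-order maximum $\mathrm{Max}(k)=\max(k)0^\omega$ and minimum $\mathrm{Min}(k)=\min(k)0^\omega$. Let $(z_n)_{n\in\mathbb{Z}}$ be the strictly increasing enumeration of $\mathbb{Z}_{-\beta}$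 with $z_0=0$. For each $n$ there is a unique $k\in\mathbb{N}$ such that for some digit $d\ge1$ and finite string $w$ over $\mathcal{A}_\beta$ beginning with $0$, the strings $w(d-1)\mathrm{Max}(k)$, $wd\,\mathrm{Min}(k)$ are admissible and $\{z_n,z_{n+1}\}=\{\gamma(w(d-1)\max(k)),\gamma(wd\min(k))\}$; set $v_n=k$ and $\boldsymbol{v}_{-\beta}=(v_n)_{n\in\mathbb{Z}}$. An antimorphism satisfies $\Phi(uw)=\Phi(w)\Phi(u)$; a morphism $\Psi$ acts on pointed bidirectional words by $\Psi(\cdots w_{-1}|w_0w_1\cdots)=\cdots\Psi(w_{-1})|\Psi(w_0)\Psi(w_1)\cdots$. *)

(* Defs.v *)
From HB Require Import structures.
From mathcomp Require Import all_boot all_order all_algebra.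
From mathcomp Require Import classical_sets reals.

Set Implicit Arguments.
Unset Strict Implicit.
Unset Printing Implicit Defensive.

Import Order.TTheory GRing.Theory Num.Theory.

Local Open Scope classical_set_scope.
Local Open Scope ring_scope.

(* An infinite string x_1 x_2 x_3 ... is a function s : nat -> nat with
   s i = x_{i+1}.  A finite string is a seq nat, leading digit first. *)

Section MinusBeta.
Context {R : realType}.
Variable beta : R.

Definition lbeta : R := - beta / (beta + 1).
Definition rbeta : R := 1 / (beta + 1).

Definition in_Ibeta (x : R) : bool := (lbeta <= x) && (x < rbeta).

Definition is_digit (a : nat) : bool := a%:Z <= Num.floor beta.

Definition digit_floor (x : R) : int :=
  Num.floor (- beta * x + beta / (beta + 1)).

Definition Tmb (x : R) : R := - beta * x - (digit_floor x)%:~R.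

(* The floor is nonnegative on I_beta, which Tmb preserves, so there the
   absolute value only casts from int to nat. *)
Definition expansion (x : R) (i : nat) : nat :=
  `|digit_floor (iter i Tmb x)|%N.

Definition admissible (s : nat -> nat) : Prop :=
  exists2 x : R, in_Ibeta x & forall i, s i = expansion x i.

(* The exponent is i.+1 because s i is the digit number i.+1. *)
Definition alt_lt (s t : nat -> nat) : Prop :=
  exists2 i : nat, (forall j, (j < i)%N -> s j = t j) &
    0 < (-1) ^+ i.+1 * ((t i)%:Z - (s i)%:Z).

Definition alt_le (s t : nat -> nat) : Prop := s =1 t \/ alt_lt s t.

(* u followed by 0^omega *)
Definition pad0 (u : seq nat) : nat -> nat := fun i => nth 0%N u i.

Definition gamma (u : seq nat) : R :=
  \sum_(i < size u) (nth 0%N (rev u) i)%:R * (- beta) ^+ i.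

Definition Zmb : set R :=
  [set x | exists u : seq nat,
     [/\ (0 < size u)%N, admissible (pad0 u) & x = gamma u]].

(* S(k), each string a_{k-1} ... a_0 0^omega being represented by its first k
   digits *)
Definition Sk (k : nat) : set (seq nat) :=
  [set u | size u = k /\ admissible (pad0 u)].

Definition is_max (k : nat) (u : seq nat) : Prop :=
  Sk k u /\ forall u', Sk k u' -> alt_le (pad0 u') (pad0 u).

Definition is_min (k : nat) (u : seq nat) : Prop :=
  Sk k u /\ forall u', Sk k u' -> alt_le (pad0 u) (pad0 u').

Definition enumerates_Zmb (z : int -> R) : Prop :=
  [/\ {homo z : m n / m < n}, range z = Zmb & z 0 = 0].

(* k is the letter attached to the pair of neighbours {x, y}; w0 is the string
   0 :: w, which begins with 0. *)
Definition gap_letter (x y : R) (k : nat) : Prop :=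
  exists (d : nat) (w maxk mink : seq nat),
    let w0 := 0%N :: w in
    let lo := w0 ++ d.-1 :: maxk in
    let hi := w0 ++ d :: mink in
    [/\ (1 <= d)%N, is_digit d & all is_digit w0] /\
    [/\ is_max k maxk, is_min k mink,
        admissible (pad0 lo), admissible (pad0 hi) &
        [set x; y] = [set gamma lo; gamma hi]].

End MinusBeta.

Definition antimorphism (Phi : seq nat -> seq nat) : Prop :=
  forall u w, Phi (u ++ w) = Phi w ++ Phi u.

Definition morphism (Psi : seq nat -> seq nat) : Prop :=
  forall u w, Psi (u ++ w) = Psi u ++ Psi w.

(* The factor v_a v_{a+1} ... v_{b-1} of a bidirectional word, for a <= b *)
Definition factor (v : int -> nat) (a b : int) : seq nat :=
  [seq v (a + i%:Z) | i <- iota 0 `|b - a|%N].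

(* The pointed bidirectional word v' is
   ... Psi(v_{-2}) Psi(v_{-1}) | Psi(v_0) Psi(v_1) ...
   For a morphism Psi, Psi(v_0 ... v_{m-1}) is a prefix of the right half and
   Psi(v_{-m} ... v_{-1}) a suffix of the left half; requiring their lengths to
   be unbounded makes them determine v'. *)
Definition image_word (Psi : seq nat -> seq nat) (v v' : int -> nat) : Prop :=
  let right m := Psi (factor v 0 m%:Z) in
  let left m := Psi (factor v (- m%:Z) 0) in
  [/\ forall m : nat, right m = factor v' 0 (size (right m))%:Z,
      forall m : nat, left m = factor v' (- (size (left m))%:Z) 0,
      forall N : nat, exists m : nat, (N <= size (right m))%N &
      forall N : nat, exists m : nat, (N <= size (left m))%N].

(* Main.v *)
(* Write val u for the number 0.u in base -beta.  A finite string is admissible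
   iff val of each of its suffixes lies in I_beta, and val is monotone for the
   alternate order, so the extremal strings can be computed digit by digit: under
   the hypotheses on d, min(k) is d_1 ... d_k, with its last digit decreased by 1
   when k is odd, and max(k+1) = 0 min(k).

   Consecutive elements of Z_{-beta} are gamma(w a max(k)) and
   gamma(w (a+1) min(k)); multiplying by -beta appends a 0.  Between
   a max(k) 0 and (a+1) min(k) 0 the neighbours are reached through a max(k+1)
   and (a+1) min(k+1), which bound a gap of letter k+1.  The strings min(k) 0 and
   min(k+1) only differ in their last two digits, so that the neighbours between
   them are obtained by incrementing the last digit (gap letter 0), with one carry
   (gap letter 1) when k is odd; the same holds for max(k+1) = 0 min(k).  Reading
   off the letters gives Phi(k). *)
Require Import Defs.
From mathcomp Require Import all_boot all_order all_algebra.
From mathcomp Require Import classical_sets reals boolp.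
From mathcomp Require Import zify ring lra.

Import Order.TTheory GRing.Theory Num.Theory.
Local Open Scope ring_scope.

(** * Factors of bidirectional words *)

Lemma size_factor (v : int -> nat) a b : size (factor v a b) = `|b - a|%N.
Proof. by rewrite size_map size_iota. Qed.

Lemma factor0 (v : int -> nat) a : factor v a a = [::].
Proof. by rewrite /factor subrr. Qed.

Lemma factor_cat (v : int -> nat) (a b c : int) : a <= b -> b <= c ->
  factor v a c = factor v a b ++ factor v b c.
Proof.
move=> ab bc; rewrite /factor.
have -> : `|c - a|%N = (`|b - a| + `|c - b|)%N by lia.
rewrite iotaD map_cat (addnC 0%N) iotaDl -map_comp.
congr cat; apply: eq_map => i /=; congr v; lia.
Qed.

Lemma factor1 (v : int -> nat) a : factor v a (a + 1) = [:: v a].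
Proof. by rewrite /factor addrC addKr /= addr0. Qed.

Lemma factorS (v : int -> nat) (a : int) n :
  factor v a (a + n.+1%:Z) = v a :: factor v (a + 1) (a + 1 + n%:Z).
Proof.
have -> : a + n.+1%:Z = a + 1 + n%:Z by lia.
by rewrite (factor_cat _ _ (a + 1)) ?factor1 //; lia.
Qed.

(** * Values and admissibility of finite strings *)

Section FiniteStrings.
Context {R : realType} (beta : R).
Hypothesis beta_gt1 : 1 < beta.

Local Ltac blra := have ? := beta_gt1; lra.
Local Ltac bnra := have ? := beta_gt1; nra.
Local Notation l := (lbeta beta).

(* The number represented by the string a_1 a_2 ... a_k 0^omega, that is,
   sum_i a_i (-beta)^(-i). *)
Fixpoint val (u : seq nat) : R :=
  if u is a :: u' then - (a%:R + val u') / beta else 0.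

Fixpoint adm (u : seq nat) : bool :=
  if u is a :: u' then in_Ibeta beta (val u) && adm u' else true.

(** The defining equation of [l] without division, in the form used by the arithmetic tactics. *)
Lemma mul_beta_lbeta : beta * l = - beta - l.
Proof. by rewrite /lbeta; field; rewrite lt0r_neq0 //; blra. Qed.

Lemma lbeta_bounds : -1 < l < 0.
Proof.
have h := mul_beta_lbeta.
by apply/andP; split; bnra.
Qed.

Lemma rbetaE : rbeta beta = l + 1.
Proof. by rewrite /lbeta /rbeta; field; rewrite lt0r_neq0 //; blra. Qed.

Lemma in_IbetaE x : in_Ibeta beta x = (l <= x < l + 1).
Proof. by rewrite /in_Ibeta rbetaE. Qed.

Lemma digit_floorE x : digit_floor beta x = Num.floor (- beta * x - l).
Proof. by rewrite /digit_floor /lbeta; congr Num.floor; ring. Qed.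

Lemma digit_floor_ge0 x : in_Ibeta beta x -> 0 <= digit_floor beta x.
Proof.
rewrite in_IbetaE digit_floorE floor_ge0 => /andP[? ?].
by have h := mul_beta_lbeta; bnra.
Qed.

Lemma Tmb_in_Ibeta x : in_Ibeta beta (Tmb beta x).
Proof.
rewrite in_IbetaE /Tmb digit_floorE.
have := floor_itv (- beta * x - l).
by rewrite intrD => /andP[? ?]; apply/andP; split; blra.
Qed.

Lemma iter_Tmb_in_Ibeta x i : in_Ibeta beta x ->
  in_Ibeta beta (iter i (Tmb beta) x).
Proof. by case: i => //= i _; exact: Tmb_in_Ibeta. Qed.

Lemma TmbE x : in_Ibeta beta x ->
  - beta * x = (expansion beta x 0)%:R + Tmb beta x.
Proof.
move=> /digit_floor_ge0 h.
by rewrite /Tmb /expansion /= -mulrz_nat natz gez0_abs //; blra.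
Qed.

Lemma val_cons a u : beta * val (a :: u) = - (a%:R + val u).
Proof. by rewrite /= mulrCA divff ?mulr1 // lt0r_neq0 //; blra. Qed.

Lemma val_cat0 u : val (u ++ [:: 0%N]) = val u.
Proof. by elim: u => [|a u /= ->] //=; rewrite addr0 oppr0 mul0r. Qed.

Lemma adm_val u : adm u -> l <= val u < l + 1.
Proof.
case: u => [_|a u] /=; last by rewrite in_IbetaE => /andP[].
by have /andP[? ?] := lbeta_bounds; apply/andP; split; blra.
Qed.

(** Multiplication by [- beta] maps [I_beta] to this interval, since [- beta * l = beta + l]. *)
Lemma adm_consE a u :
  adm (a :: u) = adm u && (l < a%:R + val u <= beta + l).
Proof.
rewrite /= andbC in_IbetaE -[- _ / _]/(val (a :: u)); congr andb.
have h := val_cons a u; have h' := mul_beta_lbeta.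
by apply/andP/andP => -[? ?]; split; bnra.
Qed.

Lemma adm_cat u w : adm (u ++ w) -> adm w.
Proof. by elim: u => //= a u IH /andP[_]. Qed.

Lemma adm_cat0 u : adm u -> adm (u ++ [:: 0%N]).
Proof.
elim: u => [_|a u IH].
  rewrite cat0s adm_consE /= add0r.
  by have /andP[? ?] := lbeta_bounds; apply/andP; split; blra.
by rewrite cat_cons !adm_consE val_cat0 => /andP[/IH -> ->].
Qed.

(** Both tails lie in one half-open interval of length 1, so the first digit decides; the factor
    [- beta] reverses the order. *)
Lemma val_head_lt u w a b : adm u -> adm w -> (a < b)%N ->
  val (b :: w) < val (a :: u).
Proof.
move=> /adm_val/andP[? ?] /adm_val/andP[? ?] ab.
have : a%:R + 1 <= b%:R :> R by rewrite natr1 ler_nat.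
by have := val_cons a u; have := val_cons b w; bnra.
Qed.

Lemma val_cons_lt a u w : (val (a :: w) < val (a :: u)) = (val u < val w).
Proof.
have := val_cons a u; have := val_cons a w.
by move=> ? ?; apply/idP/idP; bnra.
Qed.

Lemma val_inj u w : adm u -> adm w -> size u = size w -> val u = val w ->
  u = w.
Proof.
elim: u w => [|a u IH] [|b w] //= /andP[_ au] /andP[_ aw] [suw] e.
case: (ltngtP a b) => ab.
- by have := val_head_lt u w a b au aw ab; rewrite /= e ltxx.
- by have := val_head_lt w u b a aw au ab; rewrite /= e ltxx.
rewrite ab in e *; congr cons; apply: IH => //.
by have := val_cons b u; have := val_cons b w; rewrite /= e; blra.
Qed.

(** * The map [gamma] on finite strings *)

Lemma gamma_nil : gamma beta [::] = 0.
Proof. by rewrite /gamma big_ord0. Qed.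

Lemma gamma_cons a u :
  gamma beta (a :: u) = a%:R * (- beta) ^+ size u + gamma beta u.
Proof.
rewrite /gamma /= big_ord_recr /= addrC rev_cons nth_rcons size_rev ltnn eqxx.
congr (_ + _); apply: eq_bigr => i _.
by rewrite nth_rcons size_rev ltn_ord.
Qed.

Lemma gammaE u : gamma beta u = val u * (- beta) ^+ size u.
Proof.
elim: u => [|a u IH]; first by rewrite gamma_nil mul0r.
rewrite gamma_cons IH exprS mulrA mulrN [_ * beta]mulrC val_cons opprK.
by rewrite mulrDl.
Qed.

Lemma gamma_cat0 u : gamma beta (u ++ [:: 0%N]) = - beta * gamma beta u.
Proof. by rewrite !gammaE val_cat0 size_cat addn1 exprS; ring. Qed.

Lemma gamma_pad n u : gamma beta (nseq n 0%N ++ u) = gamma beta u.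
Proof. by elim: n => //= n IH; rewrite gamma_cons IH mul0r add0r. Qed.

(** * Finite strings as expansions, and the alternate order *)

Lemma Tmb_val_cons a u : adm (a :: u) ->
  digit_floor beta (val (a :: u)) = a%:Z /\ Tmb beta (val (a :: u)) = val u.
Proof.
rewrite adm_consE => /andP[/adm_val/andP[? ?] _].
have hv := val_cons a u.
have df : digit_floor beta (val (a :: u)) = a%:Z.
  rewrite digit_floorE; apply: floor_def; rewrite -pmulrn intrD -pmulrn.
  by apply/andP; split; blra.
by split=> //; rewrite /Tmb df -pmulrn; blra.
Qed.

Lemma Tmb0 : digit_floor beta 0 = 0 /\ Tmb beta 0 = 0.
Proof.
have /andP[? ?] := lbeta_bounds.
have df : digit_floor beta 0 = 0.
  by rewrite digit_floorE; apply: floor_def; rewrite add0r; apply/andP; split; blra.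
by split=> //; rewrite /Tmb df; blra.
Qed.

Lemma adm_expansion u : adm u -> pad0 u =1 expansion beta (val u).
Proof.
move=> au i; elim: i u au => [|i IH] [|a u] au.
- by rewrite /expansion /= Tmb0.1.
- by rewrite /expansion /= (Tmb_val_cons _ _ au).1.
- rewrite [RHS]/expansion iterSr Tmb0.2.
  by have := IH [::] isT; rewrite /expansion /= => <-; rewrite /pad0 !nth_nil.
rewrite [RHS]/expansion iterSr (Tmb_val_cons _ _ au).2.
by rewrite [LHS]/= IH //; case/andP: au.
Qed.

Lemma adm_admissible u : adm u -> admissible beta (pad0 u).
Proof.
move=> au; exists (val u); first by rewrite in_IbetaE adm_val.
exact: adm_expansion.
Qed.

(* If all digits vanish then |T^n x| = beta^n |x| stays bounded. *)
Lemma expansion0_eq0 x : in_Ibeta beta x ->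
  (forall i, expansion beta x i = 0%N) -> x = 0.
Proof.
move=> Ix x0.
have itx n : iter n (Tmb beta) x = (- beta) ^+ n * x.
  elim: n => [|n IH]; first by rewrite expr0 mul1r.
  have := TmbE _ (iter_Tmb_in_Ibeta _ n Ix).
  by rewrite -/(iter n.+1 _ _) [expansion _ _ _](x0 n) IH exprS; blra.
apply/eqP; apply: contraT => xN0.
have absx : 0 < `|x| by rewrite normr_gt0.
(* By Bernoulli's inequality this [m] gives [beta ^+ m * |x| > 1], while [I_beta] lies in
   [-1, 1]. *)
pose m := Num.bound (1 / ((beta - 1) * `|x|)).
have Hm : 1 < m%:R * ((beta - 1) * `|x|).
  rewrite -ltr_pdivrMr; last by apply: mulr_gt0 => //; blra.
  by apply: archi_boundP; rewrite divr_ge0 // mulr_ge0 //; blra.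
have bern n : 1 + n%:R * (beta - 1) <= beta ^+ n.
  elim: n => [|n IH]; first by rewrite expr0; blra.
  rewrite exprS -natr1.
  have n0 : 0 <= n%:R * (beta - 1) ^+ 2 :> R by rewrite mulr_ge0 ?sqr_ge0.
  by bnra.
have := iter_Tmb_in_Ibeta _ m Ix; rewrite in_IbetaE => /andP[h1 h2].
have /andP[? ?] := lbeta_bounds.
have : `|iter m (Tmb beta) x| <= 1 by rewrite ler_norml; apply/andP; split; blra.
rewrite itx normrM normrX normrN (ger0_norm (x := beta)); last by blra.
by have := bern m; bnra.
Qed.

(** The infinite tail of zeros must represent 0 by [expansion0_eq0]; the digits are then put back
    one at a time with [TmbE]. *)
Lemma admissible_adm u : admissible beta (pad0 u) -> adm u.
Proof.
move=> [x Ix ux].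
suff : adm u /\ val u = x by case.
elim: u x Ix ux => [|a u IH] x Ix ux.
  split=> //; rewrite (expansion0_eq0 _ Ix) // => i.
  by rewrite -ux /pad0 nth_nil.
have [|au vu] := IH _ (Tmb_in_Ibeta x).
  by move=> i; have := ux i.+1; rewrite /expansion iterSr.
have vx : val (a :: u) = x.
  by have := TmbE _ Ix; rewrite -ux /=; have := val_cons a u; rewrite vu /pad0 /=; bnra.
by split=> //; rewrite [adm _]/= -/(val (a :: u)) vx Ix.
Qed.

(** Prepending a digit reverses the order of [val], which matches the alternating sign; the
    induction hypothesis is therefore applied to the tails in exchanged order. *)
Lemma alt_lt_val u w : adm u -> adm w -> size u = size w ->
  alt_lt (pad0 u) (pad0 w) -> val u < val w.
Proof.
move: {2}(size u) (erefl (size u)) => n; elim: n u w => [|n IH].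
  by move=> [|//] [|//] _ _ _ _ [i _]; rewrite subrr mulr0 ltxx.
move=> [|a u] [|b w] // [su] au aw [sw] [[|i] ei].
  rewrite /pad0 /= => h; apply: val_head_lt; last by lia.
  - by case/andP: aw.
  - by case/andP: au.
have <- : a = b := ei 0%N isT.
rewrite val_cons_lt /pad0 /= => hi.
apply: IH; [by rewrite -sw|by case/andP: aw|by case/andP: au|by []|].
exists i => [j ji|]; first exact/esym/(ei j.+1).
by move: hi; rewrite exprS /pad0; lia.
Qed.

Arguments val : simpl never.
Arguments adm : simpl never.

Lemma val_cons_le a u x : (val (a :: u) <= x) = (- beta * x <= a%:R + val u).
Proof. by have hv := val_cons a u; apply/idP/idP => ?; bnra. Qed.

Lemma val_cons_ge a u x : (x <= val (a :: u)) = (a%:R + val u <= - beta * x).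
Proof. by have hv := val_cons a u; apply/idP/idP => ?; bnra. Qed.

Lemma val_cons_mono a u w : (val (a :: u) <= val (a :: w)) = (val w <= val u).
Proof. by rewrite !leNgt val_cons_lt. Qed.

(** * The expansion of [l] and the extremal strings *)

Variable d : nat -> nat.
Hypothesis d_expansion : forall i, d i.+1 = expansion beta l i.
Hypothesis d_gt0 : forall i, (0 < d i.+1)%N.
Hypothesis d_even_lt : forall i, (d (2 * i.+1) < d 1)%N.

Local Notation t j := (iter j (Tmb beta) l).

Lemma lbeta_in_Ibeta : in_Ibeta beta l.
Proof. by rewrite in_IbetaE; apply/andP; split; blra. Qed.

Lemma t_itv j : l <= t j < l + 1.
Proof. by rewrite -in_IbetaE; exact/iter_Tmb_in_Ibeta/lbeta_in_Ibeta. Qed.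

Lemma t_rec j : - beta * t j = (d j.+1)%:R + t j.+1.
Proof.
by rewrite d_expansion; apply: TmbE; exact/iter_Tmb_in_Ibeta/lbeta_in_Ibeta.
Qed.

Lemma d_ge1 j : 1 <= (d j.+1)%:R :> R.
Proof. by rewrite ler1n d_gt0. Qed.

(** Digits are at least 1 and [t j.+1 >= l > -1], so [- beta * t j] is positive. *)
Lemma t_lt0 j : t j < 0.
Proof.
have := t_rec j; have := d_ge1 j; have /andP[+ _] := t_itv j.+1.
by have /andP[? ?] := lbeta_bounds; bnra.
Qed.

(** Here [- beta * l = beta + l] equals [d 1 + t 1], and [t 1 - l] lies in [0, 1); so [d 1] is the
    floor of [beta]. *)
Lemma beta_itv : (d 1)%:R <= beta < (d 1)%:R + 1.
Proof.
have := t_rec 0; have /andP[+ +] := t_itv 1; have := mul_beta_lbeta.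
by rewrite [iter 0 _ _]/= => ? ? ? ?; apply/andP; split; blra.
Qed.

Lemma d_le j : (d j.+1 <= d 1)%N.
Proof.
rewrite -ltnS -(ltr_nat R) -natr1.
have := t_rec j; have /andP[+ _] := t_itv j.+1; have /andP[+ _] := t_itv j.
by have /andP[? ?] := beta_itv; have := mul_beta_lbeta; bnra.
Qed.

Lemma d_lt_odd j : odd j -> (d j.+1 < d 1)%N.
Proof.
move=> oj; have -> : j.+1 = (2 * j./2.+1)%N by lia.
exact: d_even_lt.
Qed.

(* The digits of t j never vanish. *)
Lemma val_neq_t u j : adm u -> val u != t j.
Proof.
elim: u j => [|a u IH] j au; first by rewrite gt_eqF //; exact: t_lt0.
apply/eqP => vt.
have hv := val_cons a u; have ht := t_rec j.
have /andP[au' _] : adm u && (in_Ibeta beta (val (a :: u))).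
  by rewrite andbC.
have /andP[? ?] := t_itv j.+1; have /andP[? ?] := adm_val _ au'.
have e : a%:R + val u = (d j.+1)%:R + t j.+1 by rewrite -ht -vt; blra.
have ad : a = d j.+1.
  apply: anti_leq; apply/andP.
  by split; rewrite -ltnS -(ltr_nat R) -natr1; blra.
by case/eqP: (IH j.+1 au'); move: e; rewrite ad; exact: addrI.
Qed.

(** The lower bound of [adm_consE] is automatic: [l] is [t 0], which no admissible finite string
    represents. *)
Lemma adm_cons a u : adm (a :: u) = adm u && (a%:R + val u <= beta + l).
Proof.
rewrite adm_consE; case: (boolP (adm u)) => //= au.
have /andP[lu _] := adm_val _ au.
have lu' : l < val u by rewrite lt_neqAle eq_sym (val_neq_t _ 0 au) lu.
by have -> : l < a%:R + val u by rewrite ltr_wpDl.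
Qed.

Lemma adm_cons_lt a u : adm u -> (a < d 1)%N -> adm (a :: u).
Proof.
rewrite adm_cons -(ler_nat R) -natr1 => au ad; rewrite au /=.
by have /andP[? ?] := adm_val _ au; have /andP[? ?] := beta_itv; blra.
Qed.

Lemma adm_cons_digit_le a u : adm (a :: u) -> (a <= d 1)%N.
Proof.
rewrite adm_cons -ltnS -(ltr_nat R) -natr1 => /andP[/adm_val/andP[? ?] ?].
by have /andP[? ?] := beta_itv; blra.
Qed.

(* For odd j and k > 0 this is the greatest admissible string of length k with
   val <= t j; for even j it is the least one with t j <= val. *)
Fixpoint cut j k : seq nat :=
  if k is k'.+1 then (d j.+1 - ((k' == 0%N) && ~~ odd j))%N :: cut j.+1 k'
  else [::].

Lemma size_cut j k : size (cut j k) = k.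
Proof. by elim: k j => //= k IH j; rewrite IH. Qed.

(** By induction on [k]: a first digit other than [d j.+1] settles the comparison, and an equal one
    leaves the tails, for which the inequality is reversed and the parity of [j] changes. *)
Lemma cut_extremal k j :
  if odd j then (0 < k)%N ->
    [/\ adm (cut j k), val (cut j k) <= t j &
        forall u, adm u -> size u = k -> val u <= t j -> val u <= val (cut j k)]
  else
    [/\ adm (cut j k), t j <= val (cut j k) &
        forall u, adm u -> size u = k -> t j <= val u -> val (cut j k) <= val u].
Proof.
elim: k j => [|k IH] j.
  case: ifP => // _; split=> //; first exact/ltW/t_lt0.
  by case.
have := IH j.+1; rewrite [odd _.+1]/=.
have /andP[? ?] := t_itv j.+1; have ht := t_rec j; have ? := t_lt0 j.+1.
case oj: (odd j) => H; rewrite [cut _ _]/= oj.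
  move=> _; rewrite andbF subn0.
  have {H}[ac tc mc] := H.
  (* The tail is at least [t j.+1], so the bound in [adm_cons] is not inherited from [t j]; it comes
     from [d j.+1 < d 1], as [j.+1] is even. *)
  split; first by apply: adm_cons_lt => //; exact: d_lt_odd.
    by rewrite val_cons_le ht lerD2l.
  move=> [|a u] // au [su]; have /andP[_ au'] := au.
  have /andP[? ?] := adm_val _ au'.
  case: (ltngtP a (d j.+1)) => ad.
  - have ? : a%:R + 1 <= (d j.+1)%:R :> R by rewrite natr1 ler_nat.
    by rewrite val_cons_le ht => ?; exfalso; blra.
  - by move=> _; apply/ltW/val_head_lt.
  by rewrite ad val_cons_le ht lerD2l val_cons_mono; exact: mc.
have bl := mul_beta_lbeta.
case: k IH H => [|k] IH H.
  (* The digit [d j.+1] followed by zeros would fall below [t j], because [t j.+1 < 0]; lowering it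
     by 1 is enough, because [t j.+1 > -1]. *)
  rewrite [cut _ _]/= subn1.
  have djE : (d j.+1).-1%:R = (d j.+1)%:R - 1 :> R.
    by rewrite -[in RHS](prednK (d_gt0 j)) -natr1 addrK.
  have v0 : val [::] = 0 by [].
  have /andP[? ?] := lbeta_bounds.
  split; first by apply: adm_cons_lt => //; have := d_le j; have := d_gt0 j; lia.
    by rewrite val_cons_ge ht djE v0; blra.
  move=> [|a [|//]] // au _; rewrite val_cons_ge ht v0 => ?.
  have : (a <= (d j.+1).-1)%N by rewrite -ltnS prednK // -(ltr_nat R); blra.
  rewrite leq_eqVlt => /predU1P[-> //|aj].
  by apply/ltW/val_head_lt.
have {H}[//|ac tc mc] := H; rewrite [_ == _]/= [_ && _]/= subn0.
have /andP[? ?] := t_itv j; have dj1 := d_ge1 j.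
split.
- have ? : - beta * t j <= beta + l by bnra.
  by rewrite adm_cons ac /=; blra.
- by rewrite val_cons_ge ht lerD2l.
move=> [|a u] // au [su]; have /andP[_ au'] := au.
have /andP[? ?] := adm_val _ au'.
case: (ltngtP a (d j.+1)) => ad.
- move=> _; apply/ltW/val_head_lt => //.
- have ? : (d j.+1)%:R + 1 <= a%:R :> R by rewrite natr1 ler_nat.
  by rewrite val_cons_ge ht => ?; exfalso; blra.
by rewrite ad val_cons_ge ht lerD2l val_cons_mono; exact: mc.
Qed.

(** As [t 0] is the left end of [I_beta], every admissible string lies above it, so [cut 0 k] is the
    minimum. *)
Definition mn k := cut 0 k.
Definition mx k := if k is k'.+1 then 0%N :: mn k' else [::].

Lemma size_mn k : size (mn k) = k. Proof. exact: size_cut. Qed.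
Lemma size_mx k : size (mx k) = k.
Proof. by case: k => //= k; rewrite size_mn. Qed.

Lemma adm_mn k : adm (mn k).
Proof. by have [] := cut_extremal k 0. Qed.

Lemma val_mn_le k u : adm u -> size u = k -> val (mn k) <= val u.
Proof.
move=> au su; have [_ _] := cut_extremal k 0; apply=> //.
by case/andP: (adm_val _ au).
Qed.

Lemma adm_mx k : adm (mx k).
Proof.
case: k => //= k; apply: (adm_cons_lt 0 _ (adm_mn k)).
exact: d_gt0.
Qed.

(** A smaller first digit makes [val] larger, so the maximum begins with 0; prepending that digit
    reverses the order, so the rest is a minimum. *)
Lemma val_mx_ge k u : adm u -> size u = k -> val u <= val (mx k).
Proof.
case: k => [|k]; first by case: u.
case: u => [|[|a] u] // au [su]; last first.
  by apply/ltW/(val_head_lt _ _ 0 a.+1) => //; [exact: adm_mn|case/andP: au].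
by rewrite val_cons_mono; apply: val_mn_le => //; case/andP: au.
Qed.

Lemma is_max_mx k u : is_max beta k u -> u = mx k.
Proof.
move=> [[su au] mu].
have /admissible_adm {}au := au.
case: (mu (mx k)); first by split; [exact: size_mx|exact/adm_admissible/adm_mx].
  by move=> e; apply/esym/(@eq_from_nth _ 0%N) => [|i _]; rewrite ?size_mx // e.
move=> /alt_lt_val h; have := val_mx_ge k u au su.
by rewrite leNgt h //; [exact: adm_mx|rewrite size_mx].
Qed.

Lemma is_min_mn k u : is_min beta k u -> u = mn k.
Proof.
move=> [[su au] mu].
have /admissible_adm {}au := au.
case: (mu (mn k)); first by split; [exact: size_mn|exact/adm_admissible/adm_mn].
  by move=> e; apply/(@eq_from_nth _ 0%N) => [|i _]; rewrite ?size_mn // -e.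
move=> /alt_lt_val h; have := val_mn_le k u au su.
by rewrite leNgt h //; [exact: adm_mn|rewrite size_mn].
Qed.

(** * Neighbouring strings and their gap letters *)

Lemma gamma_lt u w : size u = size w ->
  (gamma beta u < gamma beta w) =
  if odd (size w) then val w < val u else val u < val w.
Proof.
move=> suw; rewrite !gammaE suw exprNn -signr_odd.
have b0 : 0 < beta ^+ size w by apply: exprn_gt0; blra.
case: ifP => _; rewrite ?expr1 ?expr0 ?mul1r; last by rewrite ltr_pM2r.
by rewrite mulN1r !mulrN ltrN2 ltr_pM2r.
Qed.

Lemma gamma_inj u w : adm u -> adm w -> size u = size w ->
  gamma beta u = gamma beta w -> u = w.
Proof.
move=> au aw suw e; apply: val_inj => //; apply/eqP.
have := gamma_lt _ _ suw; have := gamma_lt _ _ (esym suw).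
by rewrite suw e ltxx; case: ifP => _; case: ltgtP.
Qed.

Lemma adm_pad n u : adm (nseq n 0%N ++ u) = adm u.
Proof.
elim: n => //= n IH; rewrite -{}IH; apply/idP/idP => [/andP[]//|au].
by apply: adm_cons_lt => //; exact: d_gt0.
Qed.

(* The strings s and w represent neighbours in Zmb beta, in either order, with
   gap letter k. *)
Definition neighbours s w k : Prop :=
  [/\ adm s, adm w & exists p a,
    (s = p ++ a :: mx k /\ w = p ++ a.+1 :: mn k) \/
    (s = p ++ a.+1 :: mn k /\ w = p ++ a :: mx k)].

Lemma neighboursC s w k : neighbours s w k -> neighbours w s k.
Proof.
by move=> [as_ aw [p [a h]]]; split=> //; exists p, a; case: h => -[]; auto.
Qed.

Lemma neighbours_size s w k : neighbours s w k -> size s = size w.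
Proof.
by move=> [_ _ [p [a [] [-> ->]]]]; rewrite !size_cat /= size_mx size_mn.
Qed.

Lemma neighbours_cat q s w k : adm (q ++ s) -> adm (q ++ w) ->
  neighbours s w k -> neighbours (q ++ s) (q ++ w) k.
Proof.
move=> aqs aqw [_ _ [p [a h]]]; split=> //; exists (q ++ p), a.
by case: h => -[-> ->]; rewrite -!catA; [left|right].
Qed.

(** For empty [p] the first chain contradicts the order of the first digits, and the second the
    extremality of [mx k] and [mn k]. Prepending a digit exchanges the two chains, so the induction
    carries both. *)
Lemma val_not_between p a k u : adm u -> size u = (size p + k.+1)%N ->
  adm (p ++ a :: mx k) -> adm (p ++ a.+1 :: mn k) ->
  ~~ (val (p ++ a :: mx k) < val u < val (p ++ a.+1 :: mn k)) &&
  ~~ (val (p ++ a.+1 :: mn k) < val u < val (p ++ a :: mx k)).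
Proof.
elim: p u => [|c p IH] [|b u] //; last first.
  move=> au [su] /= alo ahi.
  have /andP[_ au'] := au.
  have /andP[_ alo'] := alo; have /andP[_ ahi'] := ahi.
  case: (ltngtP b c) => bc.
  - have := val_head_lt _ _ _ _ au' alo' bc.
    have := val_head_lt _ _ _ _ au' ahi' bc.
    by move=> /lt_gtF -> /lt_gtF ->; rewrite !andbF.
  - have := val_head_lt _ _ _ _ alo' au' bc.
    have := val_head_lt _ _ _ _ ahi' au' bc.
    by move=> /lt_gtF -> /lt_gtF ->.
  have /andP[h1 h2] := IH _ au' su alo' ahi'.
  by rewrite bc !val_cons_lt; apply/andP; split; rewrite andbC.
move=> au [su] /= alo ahi; have /andP[_ au'] := au.
have [amx amn] := (adm_mx k, adm_mn k).
apply/andP; split.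
  apply/negP => /andP[h1 h2]; have := lt_trans h1 h2.
  by rewrite lt_gtF //; exact: val_head_lt.
apply/negP => /andP[]; case: (ltngtP b a) => [ba _|ab|->].
- by rewrite lt_gtF //; exact: val_head_lt.
- case: (ltngtP b a.+1) => [|ba|->]; first by rewrite ltnS leqNgt ab.
    by rewrite lt_gtF //; exact: val_head_lt.
  by rewrite val_cons_lt ltNge val_mn_le.
by move=> _; rewrite val_cons_lt ltNge val_mx_ge.
Qed.

Lemma gamma_not_between s w k u : neighbours s w k -> adm u ->
  size u = size s -> ~~ (gamma beta s < gamma beta u < gamma beta w).
Proof.
move=> nsw au su; have sw := neighbours_size _ _ _ nsw.
rewrite gamma_lt ?su // gamma_lt ?su // -sw.
case: nsw => as_ aw [p [a h]].
have su' : size u = (size p + k.+1)%N.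
  by case: h => -[e _]; rewrite su e size_cat /= ?size_mx ?size_mn.
case: h => -[e e']; rewrite e e' in as_ aw *.
  by case/andP: (val_not_between _ _ _ _ au su' as_ aw) => ? ?; case: ifP;
    rewrite // andbC.
by case/andP: (val_not_between _ _ _ _ au su' aw as_) => ? ?; case: ifP;
  rewrite // andbC.
Qed.

Lemma first_difference (p p' A B A' B' : seq nat) a b a' b' :
  a != b -> a' != b' ->
  p ++ a :: A = p' ++ a' :: A' -> p ++ b :: B = p' ++ b' :: B' ->
  size A = size A'.
Proof.
move=> ab ab'; elim: p p' => [|c p IH] [|c' p'] /=.
- by move=> [_ ->].
- by move=> [e _] [e' _]; rewrite e e' eqxx in ab.
- by move=> [e _] [e' _]; rewrite -e -e' eqxx in ab'.
by move=> [_ h] [_ h']; exact: IH h h'.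
Qed.

(** Padding with zeros brings both pairs to one length, where [gamma] is injective; the letter is
    then the number of digits after the first disagreement. *)
Lemma neighbours_letter_uniq s w k s' w' k' :
  neighbours s w k -> neighbours s' w' k' ->
  gamma beta s = gamma beta s' -> gamma beta w = gamma beta w' -> k = k'.
Proof.
move=> n n' es ew.
have pad (m : nat) u v i : neighbours u v i ->
    neighbours (nseq m 0%N ++ u) (nseq m 0%N ++ v) i.
  by move=> nuv; have [? ? _] := nuv; apply: neighbours_cat; rewrite ?adm_pad.
have sw := neighbours_size _ _ _ n; have sw' := neighbours_size _ _ _ n'.
have [as_ aw [p [a h]]] := pad (size s') _ _ _ n.
have [as_' aw' [p' [a' h']]] := pad (size s) _ _ _ n'.
have e1 : nseq (size s') 0%N ++ s = nseq (size s) 0%N ++ s'.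
  by apply: gamma_inj; rewrite ?gamma_pad // !size_cat !size_nseq addnC.
have e2 : nseq (size s') 0%N ++ w = nseq (size s) 0%N ++ w'.
  apply: gamma_inj; rewrite ?gamma_pad //.
  by rewrite !size_cat !size_nseq -sw -sw' addnC.
have aS b : b != b.+1 by rewrite neq_ltn ltnSn.
have Sa b : b.+1 != b by rewrite eq_sym.
rewrite -e1 -e2 in h'.
by case: h => -[h1 h2]; case: h' => -[h3 h4];
  rewrite h3 in h1; rewrite h4 in h2;
  have := first_difference _ _ _ _ _ _ _ _ _ _ _ _ (esym h1) (esym h2);
  rewrite ?size_mx ?size_mn; apply.
Qed.

(** * Walks: increasing chains of neighbours, which encode factors of [v] *)

Fixpoint walk s ks w : Prop :=
  if ks is k :: ks' then
    exists s', [/\ neighbours s s' k, gamma beta s < gamma beta s' & walk s' ks' w]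
  else s = w.

Lemma walk_cat s ks w ks' x : walk s ks w -> walk w ks' x ->
  walk s (ks ++ ks') x.
Proof.
elim: ks s => [|k ks IH] s /=; first by move=> ->.
by move=> [s' [? ? h]] h'; exists s'; split=> //; exact: IH.
Qed.

Lemma walk_spec s ks w : walk s ks w ->
  gamma beta s <= gamma beta w /\ size s = size w.
Proof.
elim: ks s => [|k ks IH] s /=; first by move=> ->.
move=> [s' [n lt_ss' /IH[le_s'w <-]]]; split; last exact: neighbours_size n.
exact: ltW (lt_le_trans lt_ss' le_s'w).
Qed.

(* By adm_cons, admissibility of a :: s is an upper bound on val s, and val is
   monotone (increasing or decreasing) in gamma along the walk. *)
Lemma walk_cons a s ks w : adm (a :: s) -> adm (a :: w) -> walk s ks w ->
  walk (a :: s) ks (a :: w).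
Proof.
elim: ks s => [|k ks IH] s /= as_ aw; first by move=> ->.
move=> [s' [n lt_ss' h]]; have [le_s'w sw'] := walk_spec _ _ _ h.
have ss' := neighbours_size _ _ _ n.
have as' : adm (a :: s').
  have [_ as' _] := n; move: as_ aw; rewrite !adm_cons as' /=.
  move: lt_ss' le_s'w; rewrite leNgt !gamma_lt //.
  by case: ifP => _ ?; rewrite -leNgt => ? /andP[_ ?] /andP[_ ?]; blra.
exists (a :: s'); split; last exact: IH.
- exact: (neighbours_cat [:: a]).
- by rewrite !gamma_cons ss' ltrD2l.
Qed.

Lemma walk_prefix p s ks w : adm (p ++ s) -> adm (p ++ w) -> walk s ks w ->
  walk (p ++ s) ks (p ++ w).
Proof.
elim: p => //= a p IH aps apw h; apply: walk_cons => //.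
by apply: IH => //; [case/andP: aps|case/andP: apw].
Qed.

Lemma adm_digit a : (a < d 1)%N -> adm [:: a].
Proof. exact: adm_cons_lt. Qed.

(** Raising the last digit by 1 is a gap of letter 0, since [mx 0] and [mn 0] are empty. *)
Lemma walk_digits a n : (a + n < d 1)%N ->
  walk [:: a] (nseq n 0%N) [:: (a + n)%N].
Proof.
elim: n a => [|n IH] a h /=; first by rewrite addn0.
exists [:: a.+1]; split.
- split; [by apply: adm_digit; lia|by apply: adm_digit; lia|].
  by exists [::], a; left.
- by rewrite !gamma_cons gamma_nil expr0 !mulr1 !addr0 ltr_nat.
- by rewrite addnS -addSn; apply: IH; lia.
Qed.

(** * Walks between extremal strings and the images of letters *)

Lemma cutD j i k :
  cut j (i + k.+1) = map d (iota j.+1 i) ++ cut (j + i) k.+1.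
Proof.
elim: i j => [|i IH] j; first by rewrite add0n addn0.
rewrite addSn [LHS]/= addnS [_ == _]/= subn0 -addnS IH addSnnS.
by [].
Qed.

Lemma mn_even k : ~~ odd k -> mn k = map d (iota 1 k).
Proof.
case: k => // k; rewrite [odd _]/= negbK => ok; rewrite /mn -addn1.
by rewrite cutD iotaD map_cat /= add0n add1n ok /= subn0.
Qed.

(** For even [k] the string [mn k.+1] is [mn k] followed by [d k.+1 - 1], so only the last digit has
    to grow from 0. *)
Lemma walk_mn_even k : ~~ odd k ->
  walk (mn k ++ [:: 0%N]) (nseq (d k.+1 - 1) 0%N) (mn k.+1).
Proof.
move=> ek; have := adm_cat0 _ (adm_mn k); have := adm_mn k.+1.
have -> : mn k.+1 = mn k ++ [:: (d k.+1 - 1)%N].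
  by rewrite [mn k]mn_even // /mn -[in LHS]addn1 cutD /= add0n ek.
move=> a1 a2; apply: walk_prefix => //.
by apply: (walk_digits 0); have := d_le k; have := d_gt0 k; lia.
Qed.

(** For odd [k] the strings end in [d k, d k.+1] and in [d k - 1, 0]: the last digit rises to
    [d 1 - 1], then one carry follows. *)
Lemma walk_mn_odd k : odd k ->
  walk (mn k.+1) (nseq (d 1 - d k.+1 - 1) 0%N ++ [:: 1%N]) (mn k ++ [:: 0%N]).
Proof.
case: k => // k ek; rewrite [odd _]/= in ek.
have := adm_cat0 _ (adm_mn k.+1); have := adm_mn k.+2.
have -> : mn k.+1 = map d (iota 1 k) ++ [:: (d k.+1 - 1)%N].
  by rewrite /mn -[in LHS]addn1 cutD /= add0n ek.
have -> : mn k.+2 = map d (iota 1 k) ++ [:: d k.+1; d k.+2].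
  by rewrite /mn -[in LHS]addn2 cutD /= add0n ek /= !subn0.
rewrite -catA /= => a1 a2; apply: walk_prefix => //.
have a12 := adm_cat _ _ a1; have a20 := adm_cat _ _ a2.
have d2 : (d k.+2 < d 1)%N by exact: d_lt_odd.
have dE : (d 1 - d k.+2 - 1 + d k.+2 = (d 1).-1)%N by lia.
have d1p : ((d 1).-1 < d 1)%N by have := d_gt0 0; lia.
(* Raising the final digit lowers its [val], so the bound known from [mn k.+2] is inherited. *)
have a11 : adm [:: d k.+1; (d 1).-1].
  move: a12; rewrite !adm_cons => /andP[_ h].
  rewrite -adm_cons adm_digit //=; apply: le_trans h; rewrite lerD2l.
  have : (d k.+2 <= (d 1).-1)%N by lia.
  rewrite leq_eqVlt => /predU1P[-> //|lt_d].
  by apply/ltW/val_head_lt.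
apply: (walk_cat _ _ [:: d k.+1; (d 1).-1]).
  apply: walk_cons => //.
  have := walk_digits (d k.+2) (d 1 - d k.+2 - 1).
  by rewrite addnC dE; apply.
(* The carry has letter 1 because [mn 1] is the digit [d 1 - 1] and [mx 1] the digit 0; it raises
   [gamma] by [beta - d 1 + 1 > 0]. *)
exists [:: (d k.+1 - 1)%N; 0%N]; split=> //.
  split=> //; exists [::], (d k.+1 - 1)%N; right.
  by rewrite /mn /= !subn1 prednK ?d_gt0.
rewrite !gamma_cons gamma_nil /= expr1 expr0 natrB ?d_gt0 //.
rewrite -subn1 natrB ?d_gt0 //.
by have /andP[? ?] := beta_itv; blra.
Qed.

(** The values of [Phi] on letters, with both parities indexed by [k] itself; 0 stands apart because
    there is no digit of index 0. *)
Definition letter_image k : seq nat :=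
  if odd k then
    nseq (d k - 1) 0%N ++ k.+1 :: nseq (d 1 - d k.+1 - 1) 0%N ++ [:: 1%N]
  else
    nseq (d k.+1 - 1) 0%N ++
    k.+1 :: (if k is 0 then [::] else nseq (d 1 - d k - 1) 0%N ++ [:: 1%N]).

(** The walk crosses the gap between [a :: mx k.+1] and [a.+1 :: mn k.+1]. All strings have length
    [k + 2], so the parity of [k] tells whether [gamma] follows or reverses [val], hence where the
    walk starts. *)
Lemma walk_letter_image a k :
  adm (a :: mx k ++ [:: 0%N]) -> adm (a.+1 :: mn k ++ [:: 0%N]) ->
  if odd k then
    walk (a :: mx k ++ [:: 0%N]) (letter_image k) (a.+1 :: mn k ++ [:: 0%N])
  else
    walk (a.+1 :: mn k ++ [:: 0%N]) (letter_image k) (a :: mx k ++ [:: 0%N]).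
Proof.
move=> alo ahi.
have [amn amx] := (adm_mn k.+1, adm_mx k.+1).
have amnS : adm (a.+1 :: mn k.+1).
  rewrite adm_cons amn /=.
  move: ahi; rewrite adm_cons => /andP[_]; apply: le_trans.
  rewrite lerD2l; apply: val_mn_le; first exact/adm_cat0/adm_mn.
  by rewrite size_cat size_mn addn1.
have amxS : adm (a :: mx k.+1).
  by apply: adm_cons_lt => //; exact: adm_cons_digit_le ahi.
have ht : val (a.+1 :: mn k.+1) < val (a :: mx k.+1) by exact: val_head_lt.
have szE : size (a :: mx k.+1) = size (a.+1 :: mn k.+1).
  by move: (mx k.+1) (mn k.+1) (size_mx k.+1) (size_mn k.+1) => u w /= -> ->.
have n : neighbours (a :: mx k.+1) (a.+1 :: mn k.+1) k.+1.
  by split=> //; exists [::], a; left.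
have adm0 u : adm u -> adm (0%N :: u) by move=> ?; exact: adm_cons_lt.
rewrite /letter_image; case ok: (odd k).
  apply: (walk_cat _ _ (a :: mx k.+1)).
    apply: walk_cons => //.
    case: k ok {szE n ahi ht amnS amn} alo amx amxS => //= k ek alo amx amxS.
    apply: walk_cons; [exact/adm0/adm_cat0/adm_mn|exact: amx|].
    exact: walk_mn_even.
  exists (a.+1 :: mn k.+1); split=> //.
    by rewrite gamma_lt // -szE /= size_mn negbK ok.
  by apply: walk_cons => //; exact: walk_mn_odd.
apply: (walk_cat _ _ (a.+1 :: mn k.+1)).
  by apply: walk_cons => //; apply: walk_mn_even; rewrite ok.
exists (a :: mx k.+1); split=> //; first exact: neighboursC.
  by rewrite gamma_lt // /= size_mn negbK ok.
(* For [k = 0] the strings [mx 0 ++ [:: 0]] and [mx 1] coincide, which is why the last block of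
   [letter_image 0] is empty. *)
case: k ok {szE n ahi ht amnS amn} alo amx amxS => //= k ek alo amx amxS.
apply: walk_cons => //.
apply: walk_cons; [exact: amx|exact/adm0/adm_cat0/adm_mn|].
by apply: walk_mn_odd; move/negbFE: ek.
Qed.

(** Appending 0 multiplies [gamma] by [- beta] and reverses the order, so the walk starts from
    [w]. *)
Lemma neighbours_image s w k : neighbours s w k ->
  gamma beta s < gamma beta w ->
  walk (w ++ [:: 0%N]) (letter_image k) (s ++ [:: 0%N]).
Proof.
move=> [as_ aw [p [a h]]] lt_sw.
have [as0 aw0] := (adm_cat0 _ as_, adm_cat0 _ aw).
(* A walk never decreases [gamma], which rules out one of the two directions in
   [walk_letter_image]. *)
have nwalk : ~ walk (s ++ [:: 0%N]) (letter_image k) (w ++ [:: 0%N]).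
  by move=> /walk_spec[+ _]; rewrite !gamma_cat0; bnra.
case: h => -[se we]; rewrite se we -!catA !cat_cons in as0 aw0 nwalk *.
  have := walk_letter_image _ _ (adm_cat _ _ as0) (adm_cat _ _ aw0).
  by case: ifP => _ h; [case: nwalk|]; exact: walk_prefix.
have := walk_letter_image _ _ (adm_cat _ _ aw0) (adm_cat _ _ as0).
by case: ifP => _ h; [|case: nwalk]; exact: walk_prefix.
Qed.

(** * The enumeration [z] and the word [v] *)

Variables (z : int -> R) (v : int -> nat).
Hypothesis z_enum : enumerates_Zmb beta z.
Hypothesis v_gap : forall n, gap_letter beta (z n) (z (n + 1)) (v n).

Lemma z_lt m n : (z m < z n) = (m < n).
Proof. by have [zh _ _] := z_enum; exact/leW_mono/le_mono. Qed.

Lemma z_inj : injective z.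
Proof.
move=> m n e; have := z_lt m n; have := z_lt n m.
by rewrite e ltxx; case: ltgtP.
Qed.

Lemma z_string n : exists2 u, adm u & z n = gamma beta u.
Proof.
have [_ zr _] := z_enum.
have : range z (z n) by exists n.
by rewrite zr => -[u [_ /admissible_adm au ->]]; exists u.
Qed.

Lemma string_z u : adm u -> exists n, z n = gamma beta u.
Proof.
have [_ zr _] := z_enum => au.
have : Zmb beta (gamma beta u).
  exists (nseq 1 0%N ++ u); split=> //; last by rewrite gamma_pad.
  by apply: adm_admissible; rewrite adm_pad.
by rewrite -zr => -[n _ <-]; exists n.
Qed.

Lemma z_neighbours n : exists s w,
  [/\ neighbours s w (v n), z n = gamma beta s & z (n + 1) = gamma beta w].
Proof.
have [[|a] [p [M [m [[// _ _ _] []]]]]] := v_gap n.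
move=> /is_max_mx -> /is_min_mn -> /admissible_adm alo /admissible_adm ahi E.
rewrite [_.+1.-1]/= in alo E.
set lo := _ ++ _ in alo E; set hi := _ ++ _ in ahi E.
have nb : neighbours lo hi (v n).
  by split=> //; exists (0%N :: p), a; left.
have zn : [set z n; z (n + 1)]%classic (z n) by left.
have zS : [set z n; z (n + 1)]%classic (z (n + 1)) by right.
have /lt_eqF/eqP nz : z n < z (n + 1) by rewrite z_lt; lia.
(* The gap letter belongs to an unordered pair, so either string may represent [z n]. *)
rewrite E in zn zS; case: zn => zn; case: zS => zS.
- by case: nz; rewrite zn zS.
- by exists lo, hi.
- by exists hi, lo; split=> //; exact: neighboursC.
- by case: nz; rewrite zn zS.
Qed.

(** Were the index of [gamma beta w] beyond [a + 1], a string for [z (a + 1)], padded to a common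
    length, would lie strictly between two neighbours. *)
Lemma neighbours_succ a s w k : neighbours s w k ->
  gamma beta s < gamma beta w -> z a = gamma beta s ->
  z (a + 1) = gamma beta w /\ v a = k.
Proof.
move=> nb lt_sw za; have [_ aw _] := nb.
have [c zc] := string_z _ aw.
have zS : z (a + 1) = gamma beta w.
  rewrite -za -zc z_lt in lt_sw.
  rewrite -zc; congr z; apply/eqP; rewrite eq_le; apply/andP; split; first by lia.
  rewrite leNgt; apply/negP => lt_c.
  have [u au zu] := z_string (a + 1).
  have /negP[] : ~~ (gamma beta s < gamma beta u < gamma beta w).
    have nb' : neighbours (nseq (size u) 0%N ++ s) (nseq (size u) 0%N ++ w) k.
      by have [? ? _] := nb; apply: neighbours_cat; rewrite ?adm_pad.
    have := gamma_not_between _ _ _ (nseq (size s) 0%N ++ u) nb'.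
    rewrite !gamma_pad adm_pad; apply=> //.
    by rewrite !size_cat !size_nseq addnC.
  by rewrite -zu -za -zc !z_lt; lia.
split=> //.
have [s' [w' [nb' zs' zw']]] := z_neighbours a.
by apply: neighbours_letter_uniq nb' nb _ _; rewrite -?zs' -?zw'.
Qed.

Lemma walk_factor a s ks w : walk s ks w -> z a = gamma beta s ->
  z (a + (size ks)%:Z) = gamma beta w /\ factor v a (a + (size ks)%:Z) = ks.
Proof.
elim: ks a s => [|k ks IH] a s /=.
  by move=> <- za; rewrite addr0 factor0.
move=> [s' [nb lt_ss' h]] za.
have [zS va] := neighbours_succ _ _ _ _ nb lt_ss' za.
have [IH1 IH2] := IH _ _ h zS.
by rewrite factorS va IH2 intS addrA.
Qed.

Lemma factor_image n a : z a = - beta * z (n + 1) ->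
  let b := a + (size (letter_image (v n)))%:Z in
  z b = - beta * z n /\ factor v a b = letter_image (v n).
Proof.
have [s [w [nb zn zS]]] := z_neighbours n.
have lt_sw : gamma beta s < gamma beta w by rewrite -zn -zS z_lt; lia.
rewrite zn zS -!gamma_cat0 => za.
exact: walk_factor (neighbours_image _ _ _ nb lt_sw) za.
Qed.

Lemma z_scale n : exists c, z c = - beta * z n.
Proof.
have [u au ->] := z_string n; rewrite -gamma_cat0.
exact/string_z/adm_cat0.
Qed.

End FiniteStrings.

Theorem theorem6p2 (R : realType) (beta : R) (d : nat -> nat)
    (z : int -> R) (v : int -> nat) (Phi : seq nat -> seq nat)
    (hbeta : (1 + Num.sqrt 5) / 2 <= beta)
    (hd : forall i : nat, d i.+1 = expansion beta (lbeta beta) i)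
    (hdi : forall i : nat, (1 <= i)%N -> (0 < d i)%N /\ (d (2 * i)%N < d 1%N)%N)
    (hz : enumerates_Zmb beta z)
    (hv : forall n : int, gap_letter beta (z n) (z (n + 1)) (v n))
    (hPhi : antimorphism Phi)
    (hPhi0 : Phi [:: 0%N] = nseq (d 1%N - 1) 0%N ++ [:: 1%N])
    (hPhi_even : forall l : nat, (1 <= l)%N ->
       Phi [:: (2 * l)%N] =
         nseq (d (2 * l + 1)%N - 1) 0%N ++ [:: (2 * l + 1)%N] ++
         nseq (d 1%N - d (2 * l)%N - 1) 0%N ++ [:: 1%N])
    (hPhi_odd : forall l : nat,
       Phi [:: (2 * l + 1)%N] =
         nseq (d (2 * l + 1)%N - 1) 0%N ++ [:: (2 * l + 2)%N] ++
         nseq (d 1%N - d (2 * l + 2)%N - 1) 0%N ++ [:: 1%N]) :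
  (forall n a b : int, a < b ->
     z a = - beta * z (n + 1) -> z b = - beta * z n ->
     Phi [:: v n] = factor v a b) /\
  (morphism (fun u => Phi (Phi u)) /\
   image_word (fun u => Phi (Phi u)) v v).
Proof.
have beta_gt1 : 1 < beta.
  apply: lt_le_trans hbeta; rewrite ltr_pdivlMr // mul1r ltrD2l.
  by rewrite -[ltLHS]sqrtr1 ltr_sqrt // ltr1n.
have d_gt0 i : (0 < d i.+1)%N by case: (hdi i.+1).
have d_even_lt i : (d (2 * i.+1) < d 1)%N by case: (hdi i.+1).
have Phi_letter k : Phi [:: k] = letter_image d k.
  have [kE|kO] := boolP (odd k).
    have {1}-> : k = (2 * k./2 + 1)%N by lia.
    rewrite hPhi_odd /letter_image kE.
    by have [-> ->] : (2 * k./2 + 1 = k)%N /\ (2 * k./2 + 2 = k.+1)%N by lia.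
  case: k kO => [|k] kO; first by rewrite hPhi0.
  have {1}-> : k.+1 = (2 * k.+1./2)%N by lia.
  rewrite hPhi_even; last by lia.
  have [-> ->] : (2 * k.+1./2 = k.+1)%N /\ (2 * k.+1./2 + 1 = k.+2)%N by lia.
  by rewrite /letter_image (negbTE kO).
have image n a := factor_image _ beta_gt1 _ hd d_gt0 d_even_lt _ _ hz hv n a.
have zlt := z_lt _ _ hz; have zinj := z_inj _ _ hz.
have Phi_factor n a b : z a = - beta * z (n + 1) -> z b = - beta * z n ->
    Phi [:: v n] = factor v a b.
  move=> /image /= [zb fab] zb'.
  by rewrite Phi_letter -fab; congr factor; apply: zinj; rewrite zb zb'.
split; first by move=> n a b _; exact: Phi_factor.
split; first by move=> u w; rewrite !hPhi.
have Phi_nil : Phi [::] = [::].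
  by apply/nilP; have := congr1 size (hPhi [::] [::]); rewrite cat0s size_cat /nilp; lia.
(* [sg n] is the index of [- beta * z n]. *)
have [sg zsg] := choice (z_scale _ beta_gt1 _ hd d_gt0 _ hz).
have sg_lt m n : (sg m < sg n) = (n < m).
  by rewrite -zlt !zsg !mulNr ltrN2 ltr_pM2l ?zlt //; lra.
have sg_le m n : (sg m <= sg n) = (n <= m) by rewrite !leNgt sg_lt.
have sg0 : sg 0 = 0 by apply: zinj; have [_ _ z0] := hz; rewrite zsg z0 mulr0.
(* [Phi] reverses concatenation and [sg] reverses the order, so the images of consecutive letters
   fit together from right to left. *)
have Phi_factors p q : p <= q -> Phi (factor v p q) = factor v (sg q) (sg p).
  move=> pq; have -> : q = p + `|q - p|%N%:Z by lia.
  elim: `|q - p|%N => [|n IH]; first by rewrite addr0 !factor0.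
  rewrite (factor_cat _ _ (p + n%:Z)); [|by lia|by lia].
  have -> : p + n.+1%:Z = p + n%:Z + 1 by lia.
  rewrite factor1 hPhi IH (Phi_factor _ (sg (p + n%:Z + 1)) (sg (p + n%:Z))) //.
  by rewrite -factor_cat // sg_le; lia.
have sg2_lt m n : (sg (sg m) < sg (sg n)) = (m < n) by rewrite !sg_lt.
have Phi2 p q : p <= q ->
    Phi (Phi (factor v p q)) = factor v (sg (sg p)) (sg (sg q)).
  by move=> pq; rewrite !Phi_factors // sg_le.
(* The square of [sg] is strictly increasing and fixes 0, so it moves no integer closer to 0; this
   makes the lengths of the images unbounded. *)
have sg2_ge (m : nat) : m%:Z <= sg (sg m%:Z).
  elim: m => [|m IH]; first by rewrite !sg0.
  by have := sg2_lt m%:Z m.+1%:Z; lia.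
have sg2_le (m : nat) : sg (sg (- m%:Z)) <= - m%:Z.
  elim: m => [|m IH]; first by rewrite oppr0 !sg0.
  by have := sg2_lt (- m.+1%:Z) (- m%:Z); lia.
split=> m /=.
- rewrite Phi2 // size_factor !sg0; congr factor.
  by have := sg2_ge m; lia.
- rewrite Phi2; last by lia.
  rewrite size_factor !sg0; congr factor.
  by have := sg2_le m; lia.
- by exists m; rewrite Phi2 // size_factor !sg0; have := sg2_ge m; lia.
exists m; rewrite Phi2; last by lia.
by rewrite size_factor !sg0; have := sg2_le m; lia.
Qed.
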